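(* Let $(S,\leq)$ be a directed set with associated direct category $\mathcal{S}$, let $G$ be a group acting on $\mathcal{S}$, and let $F:\mathcal{S}\to\mathscr{G}rp$ be a $G$-equivariant functor (with $G$ acting trivially on $\mathscr{G}rp$). Then the $G$-equivariant direct limit $\varinjlim^{G}F$ is isomorphic to a semidirect product of $\varinjlim F$ and $G$; that is, there is a homomorphism $\phi:G\to\mathrm{Aut}(\varinjlim F)$ such that $\varinjlim^{G}F\cong(\varinjlim F)\rtimes_{\phi}G$ as groups.
   Context: A directed set $(S,\le)$ is a nonempty partially ordered set in which any two elements have a common upper bound. Its direct category $\mathcal{S}$ has object set $S$ and a single morphism $\iota_A^B:A\to B$ whenever $A\le B$ (and no others). $\mathscr{G}rp$ is the category of groups; $\varinjlim F$ is the usual direct limit (colimit) of $F$. A group $G$ acts on $\mathcal{S}$ by a group homomorphism from $G$ to the group of strictly invertible functors $\mathcal{S}\to\mathcal{S}$; write $f(A)$ for the action of $f\in G$ on an object $A$; necessarily $f(\iota_A^B)=\iota_{f(A)}^{f(B)}$. With trivial action on $\mathscr{G}rp$, $G$-equivariance of $F$ means: $F(f(A))=F(A)$ for all $f\in G$, $A\in S$, and $F(\iota_{f(A)}^{f(B)})=F(\iota_A^B)$ for all $A\le B$. The category $\mathcal{S}_G$: its objects are the elements of $S$; the morphisms from $B$ to $A$ are the triples $(A,\alpha,f)$ with $\alpha\in F(A)$, $f\in G$, $f(B)=A$; composition is $(A,\alpha,f)\circ(B,\beta,g)=(A,\alpha\beta,fg)$ when $f(B)=A$ (note $F(B)=F(f(B))=F(A)$).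 The equivalence relation $\sim$ on the morphisms of $\mathcal{S}_G$: $(A,\alpha,f)\sim(B,\beta,g)$ iff $f=g$ and $F(\iota_A^C)(\alpha)=F(\iota_B^C)(\beta)$ for some $C\in S$ with $A\le C$, $B\le C$. (This is a concentration structure on $\mathcal{S}_G$, which makes the following multiplication well defined.) The $G$-equivariant direct limit $\varinjlim^{G}F$ is the concentration group of $(\mathcal{S}_G,\sim)$: the set of $\sim$-classes of morphisms of $\mathcal{S}_G$, with multiplication $[x][y]=[x'\circ y']$ for any $x'\sim x$, $y'\sim y$ such that $x'\circ y'$ exists. *)

(* Defs.v *)
From HB Require Import structures.
From mathcomp Require Import all_boot all_order.
From mathcomp Require Import boolp.
Set Implicit Arguments. Unset Strict Implicit. Unset Printing Implicit Defensive.
Import Order.TTheory.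

Local Open Scope quotient_scope.
Local Open Scope order_scope.
Local Open Scope group_scope.

Definition isomorphic (G H : groupType) : Prop :=
  exists f : {multiplicative G -> H}, bijective f.

(* The product [s * t] is [s \o t], opposite to the convention of perm.v. *)
Record groupAut (L : groupType) := GroupAut {
  gaut_fun :> L -> L;
  gaut_inv : L -> L;
  gautM : {morph gaut_fun : x y / x * y};
  gautK : cancel gaut_fun gaut_inv;
  gautVK : cancel gaut_inv gaut_fun }.

Section GroupAut.
Variable L : groupType.
Implicit Types s t : groupAut L.

Lemma groupAut_eq s t : s =1 t -> s = t.
Proof.
case: s => f f' fM fK f'K; case: t => g g' gM gK g'K /= /funext e.
subst g; have e : f' = g' by apply/funext => x; rewrite -{1}[x]g'K fK.
by subst g'; congr GroupAut; apply: Prop_irrelevance.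
Qed.

Definition gaut_one : groupAut L :=
  @GroupAut L id id (fun _ _ => erefl) (fun _ => erefl) (fun _ => erefl).

Fact gaut_mul_morph s t : {morph s \o t : x y / x * y}.
Proof. by move=> x y /=; rewrite !gautM. Qed.

Definition gaut_mul s t : groupAut L :=
  GroupAut (gaut_mul_morph s t)
    (can_comp (gautK s) (gautK t)) (can_comp (gautVK t) (gautVK s)).

Fact gaut_inv_morph s : {morph gaut_inv s : x y / x * y}.
Proof. by move=> x y; apply: (can_inj (gautK s)); rewrite gautM !gautVK. Qed.

Definition gaut_opp s : groupAut L :=
  GroupAut (gaut_inv_morph s) (gautVK s) (gautK s).

HB.instance Definition _ := gen_eqMixin (groupAut L).
HB.instance Definition _ := gen_choiceMixin (groupAut L).

Fact gaut_mulA : associative gaut_mul.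
Proof. by move=> s t u; apply: groupAut_eq. Qed.
Fact gaut_mul1 : left_id gaut_one gaut_mul.
Proof. by move=> s; apply: groupAut_eq. Qed.
Fact gaut_mulr1 : right_id gaut_one gaut_mul.
Proof. by move=> s; apply: groupAut_eq. Qed.
Fact gaut_mulV : left_inverse gaut_one gaut_opp gaut_mul.
Proof. by move=> s; apply: groupAut_eq => x /=; rewrite gautK. Qed.
Fact gaut_mulrV : right_inverse gaut_one gaut_opp gaut_mul.
Proof. by move=> s; apply: groupAut_eq => x /=; rewrite gautVK. Qed.

HB.instance Definition _ := isGroup.Build (groupAut L)
  gaut_mulA gaut_mul1 gaut_mulr1 gaut_mulV gaut_mulrV.

End GroupAut.

Definition semidirect (L G : groupType)
  (phi : {multiplicative G -> groupAut L}) : Type := (L * G)%type.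

Section Semidirect.
Variables (L G : groupType) (phi : {multiplicative G -> groupAut L}).
Local Notation T := (semidirect phi).

HB.instance Definition _ := Choice.copy T (L * G)%type.

Definition sd_mul (x y : T) : T := (x.1 * phi x.2 y.1, x.2 * y.2).
Definition sd_one : T := (1, 1).
Definition sd_inv (x : T) : T := (phi x.2^-1 x.1^-1, x.2^-1).

Let phi1 x : phi 1 x = x.
Proof.
have := congr1 (fun s : groupAut L => s x) (@gmulfM _ _ phi 1 1).
by rewrite mulg1 /= => /(can_inj (gautK _)).
Qed.
Let phiM f g x : phi (f * g) x = phi f (phi g x).
Proof. by rewrite gmulfM. Qed.
Let gaut1 (s : groupAut L) : s 1 = 1.
Proof.
by apply: (@mulgI _ (s 1)); rewrite -gautM !mulg1.
Qed.

Fact sd_mulA : associative sd_mul.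
Proof.
by move=> x y z; rewrite /sd_mul /= gautM phiM !mulgA.
Qed.
Fact sd_mul1 : left_id sd_one sd_mul.
Proof. by case=> x f; rewrite /sd_mul /= phi1 !mul1g. Qed.
Fact sd_mulr1 : right_id sd_one sd_mul.
Proof. by case=> x f; rewrite /sd_mul /= gaut1 !mulg1. Qed.
Fact sd_mulV : left_inverse sd_one sd_inv sd_mul.
Proof.
by case=> x f; rewrite /sd_mul /= -gautM !mulVg gaut1.
Qed.
Fact sd_mulrV : right_inverse sd_one sd_inv sd_mul.
Proof.
by case=> x f; rewrite /sd_mul /= -phiM !mulgV phi1 mulgV.
Qed.

HB.instance Definition _ := isGroup.Build T
  sd_mulA sd_mul1 sd_mulr1 sd_mulV sd_mulrV.

End Semidirect.

Definition directed {d : Order.disp_t} (S : porderType d) : Prop :=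
  inhabited S /\ forall A B : S, exists C, A <= C /\ B <= C.

(* Strictly invertible endofunctors of the direct category of S. Its hom-sets
   have at most one element, so such a functor is its object map, subject to
   monotonicity. *)
Record dirAut {d : Order.disp_t} (S : porderType d) := DirAut {
  daut_fun :> S -> S;
  daut_inv : S -> S;
  daut_homo : {homo daut_fun : A B / A <= B};
  daut_inv_homo : {homo daut_inv : A B / A <= B};
  dautK : cancel daut_fun daut_inv;
  dautVK : cancel daut_inv daut_fun }.

Section DirAut.
Variables (d : Order.disp_t) (S : porderType d).
Implicit Types s t : dirAut S.

Lemma dirAut_eq s t : s =1 t -> s = t.
Proof.
case: s => f f' fM f'M fK f'K; case: t => g g' gM g'M gK g'K /= /funext e.
subst g; have e : f' = g' by apply/funext => x; rewrite -{1}[x]g'K fK.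
by subst g'; congr DirAut; apply: Prop_irrelevance.
Qed.

Definition daut_one : dirAut S :=
  @DirAut d S id id (fun _ _ => id) (fun _ _ => id)
    (fun _ => erefl) (fun _ => erefl).

Definition daut_mul s t : dirAut S :=
  @DirAut d S (s \o t) (daut_inv t \o daut_inv s)
    (fun A B l => daut_homo s (daut_homo t l))
    (fun A B l => daut_inv_homo t (daut_inv_homo s l))
    (can_comp (dautK s) (dautK t)) (can_comp (dautVK t) (dautVK s)).

Definition daut_opp s : dirAut S :=
  DirAut (@daut_inv_homo _ _ s) (@daut_homo _ _ s) (dautVK s) (dautK s).

HB.instance Definition _ := gen_eqMixin (dirAut S).
HB.instance Definition _ := gen_choiceMixin (dirAut S).

Fact daut_mulA : associative daut_mul.
Proof. by move=> s t u; apply: dirAut_eq. Qed.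
Fact daut_mul1 : left_id daut_one daut_mul.
Proof. by move=> s; apply: dirAut_eq. Qed.
Fact daut_mulr1 : right_id daut_one daut_mul.
Proof. by move=> s; apply: dirAut_eq. Qed.
Fact daut_mulV : left_inverse daut_one daut_opp daut_mul.
Proof. by move=> s; apply: dirAut_eq => x /=; rewrite dautK. Qed.
Fact daut_mulrV : right_inverse daut_one daut_opp daut_mul.
Proof. by move=> s; apply: dirAut_eq => x /=; rewrite dautVK. Qed.

HB.instance Definition _ := isGroup.Build (dirAut S)
  daut_mulA daut_mul1 daut_mulr1 daut_mulV daut_mulrV.

End DirAut.

(* [fmap l] is the image of the unique morphism A -> B, for l : A <= B. *)
Record grpFunctor {d : Order.disp_t} (S : porderType d) := GrpFunctor {
  fobj :> S -> groupType;
  fmap : forall A B : S, A <= B -> {multiplicative fobj A -> fobj B};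
  fmap_id : forall (A : S) (l : A <= A) x, fmap l x = x;
  fmap_comp : forall (A B C : S) (lAB : A <= B) (lBC : B <= C) (lAC : A <= C) x,
    fmap lAC x = fmap lBC (fmap lAB x) }.

Definition castT (T U : Type) (e : T = U) (x : T) : U := ecast V V e x.

(* Strict equality of groups: equal carriers and equal multiplications. A
   [groupType] also carries a choice operator, which is not part of the group;
   equality in [groupType] would constrain it too. *)
Record group_eq (G H : groupType) : Prop := GroupEq {
  group_eq_sort : (G : Type) = (H : Type);
  group_eq_mul : forall x y : G,
    castT group_eq_sort (x * y) = castT group_eq_sort x * castT group_eq_sort y }.

Record equivariant {d : Order.disp_t} (S : porderType d) (G : groupType)
    (act : {multiplicative G -> dirAut S}) (F : grpFunctor S) : Prop :=
  Equivariant {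
  equi_obj : forall (f : G) (A : S), group_eq (F (act f A)) (F A);
  equi_map : forall (f : G) (A B : S) (l : A <= B) (x : F (act f A)),
    castT (group_eq_sort (equi_obj f B)) (fmap F (daut_homo (act f) l) x)
    = fmap F l (castT (group_eq_sort (equi_obj f A)) x) }.

Lemma castT_id (T : Type) (e : T = T) x : castT e x = x.
Proof. by rewrite (Prop_irrelevance e erefl). Qed.

Lemma castT_comp (T U V : Type) (e : T = U) (e' : U = V) (e'' : T = V) x :
  castT e' (castT e x) = castT e'' x.
Proof. by subst U; subst V; rewrite !castT_id. Qed.

Section DirectLimit.
Variables (d : Order.disp_t) (S : porderType d).
Hypothesis hS : directed S.
Variable F : grpFunctor S.

Definition dl_elt := {A : S & F A}.

HB.instance Definition _ := gen_eqMixin dl_elt.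
HB.instance Definition _ := gen_choiceMixin dl_elt.

Definition dl_rel (x y : dl_elt) : Prop :=
  exists (C : S) (lx : tag x <= C) (ly : tag y <= C),
    fmap F lx (tagged x) = fmap F ly (tagged y).

Lemma fmap_fmap (A B C : S) (lAB : A <= B) (lBC : B <= C) x :
  fmap F lBC (fmap F lAB x) = fmap F (le_trans lAB lBC) x.
Proof. by rewrite -(fmap_comp lAB lBC (le_trans lAB lBC)). Qed.

Lemma fmap1 (A B : S) (l : A <= B) : fmap F l 1 = 1.
Proof. by apply: (@mulgI _ (fmap F l 1)); rewrite -gmulfM !mulg1. Qed.

Lemma directed_ub A B : exists C : S, A <= C /\ B <= C.
Proof. exact: (proj2 hS). Qed.

Lemma fmap_eq_up (A B C D : S) (lA : A <= C) (lB : B <= C) (lA' : A <= D)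
    (lB' : B <= D) x y :
  C <= D -> fmap F lA x = fmap F lB y -> fmap F lA' x = fmap F lB' y.
Proof.
move=> lCD e; rewrite (fmap_comp lA lCD lA') e fmap_fmap.
by rewrite (bool_irrelevance lB' (le_trans lB lCD)).
Qed.

Lemma dl_refl x : dl_rel x x.
Proof. by exists (tag x), (lexx _), (lexx _). Qed.

Lemma dl_sym x y : dl_rel x y -> dl_rel y x.
Proof. by case=> C [lx [ly e]]; exists C, ly, lx. Qed.

Lemma dl_trans x y z : dl_rel x y -> dl_rel y z -> dl_rel x z.
Proof.
move=> [C [lx [ly e]]] [D [ly' [lz e']]].
have [E [lC lD]] := directed_ub C D.
exists E, (le_trans lx lC), (le_trans lz lD).
rewrite (fmap_eq_up _ (le_trans ly lC) lC e).
exact: fmap_eq_up lD e'.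
Qed.

Lemma dl_equivP : equiv_class_of (fun x y : dl_elt => `[< dl_rel x y >]).
Proof.
split=> [x|x y|y x z].
- exact/asboolP/dl_refl.
- by apply: asbool_equiv_eq; split; apply: dl_sym.
- by move=> /asboolP h1 /asboolP h2; apply/asboolP; apply: dl_trans h1 h2.
Qed.

Canonical dl_equiv := EquivRelPack dl_equivP.

Definition dirlim : Type := {eq_quot dl_equiv}.
HB.instance Definition _ := Choice.on dirlim.

(* The class of x in F A. *)
Definition dl_in (A : S) (x : F A) : dirlim :=
  \pi_({eq_quot dl_equiv}) (Tagged (fun B : S => F B) x).

Lemma dl_inP (A B : S) (x : F A) (y : F B) :
  dl_in x = dl_in y <->
  exists (C : S) (lA : A <= C) (lB : B <= C), fmap F lA x = fmap F lB y.
Proof.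
split=> [/eqmodP/asboolP //|h]; exact/eqmodP/asboolP.
Qed.

Lemma dl_in_fmap (A B : S) (l : A <= B) x : dl_in (fmap F l x) = dl_in x.
Proof.
by apply/dl_inP; exists B, (lexx _), l; rewrite fmap_id.
Qed.

Lemma dl_in_surj (X : dirlim) : exists (A : S) (x : F A), X = dl_in x.
Proof.
exists (tag (repr X)), (tagged (repr X)).
by rewrite /dl_in -[LHS]reprK; case: (repr X).
Qed.

Lemma dl_in_surj_at (X : dirlim) (A : S) :
  exists (B : S) (x : F B), A <= B /\ X = dl_in x.
Proof.
have [B [x ->]] := dl_in_surj X; have [C [lA lB]] := directed_ub A B.
by exists C, (fmap F lB x); rewrite dl_in_fmap.
Qed.

(* Multiplication of classes: [x][y] = [xy] for x, y in the same F A. *)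
Lemma dl_mul_ex (X Y : dirlim) : exists Z : dirlim, forall (A : S) (x y : F A),
  X = dl_in x -> Y = dl_in y -> Z = dl_in (x * y).
Proof.
have [A [x ->]] := dl_in_surj X; have [B [y [l ->]]] := dl_in_surj_at Y A.
exists (dl_in (fmap F l x * y)) => C x' y'.
move=> /dl_inP[D [lAD [lCD ex]]] /dl_inP[E [lBE [lCE ey]]].
have [H [lD lE]] := directed_ub D E.
apply/dl_inP; exists H, (le_trans lBE lE), (le_trans lCD lD).
rewrite !gmulfM fmap_fmap; congr (_ * _).
  exact: fmap_eq_up lD ex.
exact: fmap_eq_up lE ey.
Qed.

Definition dl_mul (X Y : dirlim) : dirlim := projT1 (cid (dl_mul_ex X Y)).

Lemma dl_mulE (A : S) (x y : F A) : dl_mul (dl_in x) (dl_in y) = dl_in (x * y).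
Proof. by rewrite /dl_mul; case: cid => Z /= h; apply: h. Qed.

Lemma dl_one_ex : exists Z : dirlim, forall A : S, Z = dl_in (1 : F A).
Proof.
case: hS => [[A] _]; exists (dl_in (1 : F A)) => B; apply/dl_inP.
have [C [lA lB]] := directed_ub A B.
by exists C, lA, lB; rewrite !fmap1.
Qed.

Definition dl_one : dirlim := projT1 (cid dl_one_ex).

Lemma dl_oneE (A : S) : dl_one = dl_in (1 : F A).
Proof. by rewrite /dl_one; case: cid => Z /= h; apply: h. Qed.

Definition dl_inv (X : dirlim) : dirlim :=
  dl_in ((tagged (repr X : dl_elt))^-1).

Fact dl_mulA : associative dl_mul.
Proof.
move=> X Y Z; have [A [x ->]] := dl_in_surj X.
have [B [y [lAB ->]]] := dl_in_surj_at Y A.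
have [C [z [lBC ->]]] := dl_in_surj_at Z B.
rewrite -(dl_in_fmap (le_trans lAB lBC) x) -(dl_in_fmap lBC y).
by rewrite !dl_mulE mulgA.
Qed.
Fact dl_mul1 : left_id dl_one dl_mul.
Proof.
by move=> X; have [A [x ->]] := dl_in_surj X; rewrite (dl_oneE A) dl_mulE mul1g.
Qed.
Fact dl_mulr1 : right_id dl_one dl_mul.
Proof.
by move=> X; have [A [x ->]] := dl_in_surj X; rewrite (dl_oneE A) dl_mulE mulg1.
Qed.
Lemma dl_reprK (X : dirlim) : X = dl_in (tagged (repr X : dl_elt)).
Proof. by rewrite /dl_in -[LHS]reprK; case: (repr X). Qed.
Fact dl_mulV : left_inverse dl_one dl_inv dl_mul.
Proof.
by move=> X; rewrite {2}[X]dl_reprK dl_mulE mulVg -dl_oneE.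
Qed.
Fact dl_mulrV : right_inverse dl_one dl_inv dl_mul.
Proof.
by move=> X; rewrite {1}[X]dl_reprK dl_mulE mulgV -dl_oneE.
Qed.

HB.instance Definition _ := isGroup.Build dirlim
  dl_mulA dl_mul1 dl_mulr1 dl_mulV dl_mulrV.

Fact dl_in_morph (A : S) : {morph @dl_in A : x y / x * y}.
Proof. by move=> x y; rewrite -dl_mulE. Qed.
HB.instance Definition _ (A : S) :=
  isMultiplicative.Build (F A) dirlim (@dl_in A) (@dl_in_morph A).

Theorem dirlim_universal (H : groupType)
    (k : forall A : S, {multiplicative F A -> H}) :
  (forall (A B : S) (l : A <= B) x, k B (fmap F l x) = k A x) ->
  exists u : {multiplicative dirlim -> H},
    (forall (A : S) (x : F A), u (dl_in x) = k A x) /\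
    (forall v : {multiplicative dirlim -> H},
       (forall (A : S) (x : F A), v (dl_in x) = k A x) -> v =1 u).
Proof.
move=> kc.
have uE (X : dirlim) : exists h : H, forall (A : S) (x : F A), X = dl_in x -> h = k A x.
  have [A [x ->]] := dl_in_surj X; exists (k A x) => B y.
  by case/dl_inP=> C [lA [lB e]]; rewrite -(kc _ _ lA) e kc.
pose u X := projT1 (cid (uE X)).
have uin (A : S) (x : F A) : u (dl_in x) = k A x.
  by rewrite /u; case: cid => h /= hE; apply: hE.
have uM : {morph u : X Y / X * Y}.
  move=> X Y; have [A [x ->]] := dl_in_surj X.
  have [B [y [l ->]]] := dl_in_surj_at Y A.
  by rewrite -(dl_in_fmap l x) -gmulfM !uin gmulfM.
pose um := isMultiplicative.Build dirlim H u uM.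
exists (HB.pack_for {multiplicative dirlim -> H} u um); split=> //= v vin X.
by have [A [x ->]] := dl_in_surj X; rewrite vin uin.
Qed.

End DirectLimit.

(* The triples (A, alpha, f). The source of such a morphism is the unique B
   with f(B) = A, so it need not be recorded. *)
Record sgMor {d : Order.disp_t} (S : porderType d) (G : groupType)
    (F : grpFunctor S) := SgMor {
  sg_tgt : S;
  sg_val : F sg_tgt;
  sg_act : G }.

Section EquivariantDirectLimit.
Variables (d : Order.disp_t) (S : porderType d) (G : groupType).
Hypothesis hS : directed S.
Variables (act : {multiplicative G -> dirAut S}) (F : grpFunctor S).
Hypothesis hF : equivariant act F.

Local Notation mor := (sgMor G F).

HB.instance Definition _ := gen_eqMixin mor.
HB.instance Definition _ := gen_choiceMixin mor.

Definition sg_hom (B A : S) (x : mor) : Prop :=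
  sg_tgt x = A /\ act (sg_act x) B = A.

Definition sg_composable (x y : mor) : Prop := sg_hom (sg_tgt y) (sg_tgt x) x.

(* The identification F(B) = F(f(B)) = F(A). *)
Definition sg_transport (f : G) (B A : S) (h : act f B = A) : F B -> F A :=
  castT (etrans (esym (group_eq_sort (equi_obj hF f B)))
                (congr1 (fun C : S => (F C : Type)) h)).

Definition sg_comp (x y : mor) (h : sg_composable x y) : mor :=
  @SgMor d S G F (sg_tgt x)
    (sg_val x * sg_transport (proj2 h) (sg_val y))
    (sg_act x * sg_act y).

Definition sg_rel (x y : mor) : Prop :=
  sg_act x = sg_act y /\
  exists (C : S) (lx : sg_tgt x <= C) (ly : sg_tgt y <= C),
    fmap F lx (sg_val x) = fmap F ly (sg_val y).

Lemma sg_refl x : sg_rel x x.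
Proof. by split=> //; exists (sg_tgt x), (lexx _), (lexx _). Qed.

Lemma sg_sym x y : sg_rel x y -> sg_rel y x.
Proof. by case=> e [C [lx [ly e']]]; split=> //; exists C, ly, lx. Qed.

Lemma sg_trans x y z : sg_rel x y -> sg_rel y z -> sg_rel x z.
Proof.
move=> [e0 [C [lx [ly e]]]] [e0' [D [ly' [lz e']]]].
split; first exact: etrans e0 e0'.
have [E [lC lD]] := directed_ub hS C D.
exists E, (le_trans lx lC), (le_trans lz lD).
rewrite (fmap_eq_up _ (le_trans ly lC) lC e).
exact: fmap_eq_up lD e'.
Qed.

Lemma sg_equivP : equiv_class_of (fun x y : mor => `[< sg_rel x y >]).
Proof.
split=> [x|x y|y x z].
- exact/asboolP/sg_refl.
- by apply: asbool_equiv_eq; split; apply: sg_sym.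
- by move=> /asboolP h1 /asboolP h2; apply/asboolP; apply: sg_trans h1 h2.
Qed.

Canonical sg_equiv := EquivRelPack sg_equivP.

(* The parameter [hF] fixes the multiplication, not the underlying type. *)
Definition eqdirlim of equivariant act F : Type := {eq_quot sg_equiv}.
Local Notation L := (eqdirlim hF).
HB.instance Definition _ := Choice.copy L {eq_quot sg_equiv}.

Definition sg_class (x : mor) : L := \pi_({eq_quot sg_equiv}) x.

Lemma sg_classP x y : sg_class x = sg_class y <-> sg_rel x y.
Proof. by split=> [/eqmodP/asboolP //|h]; exact/eqmodP/asboolP. Qed.

Lemma sg_class_surj (X : L) : exists x, X = sg_class x.
Proof. by exists (repr (X : {eq_quot sg_equiv})); rewrite /sg_class reprK. Qed.

Lemma act1 (A : S) : act 1 A = A.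
Proof.
have := congr1 (fun s : dirAut S => s A) (@gmulfM _ _ act 1 1).
by rewrite mulg1 /= => /(can_inj (dautK _)).
Qed.

Lemma actM f g (A : S) : act (f * g) A = act f (act g A).
Proof. by rewrite gmulfM. Qed.

Lemma actVK f (A : S) : act f (act f^-1 A) = A.
Proof. by rewrite -actM mulgV act1. Qed.

Lemma actKV f (A : S) : act f^-1 (act f A) = A.
Proof. by rewrite -actM mulVg act1. Qed.

Lemma act_leV f (A B : S) : act f A <= B -> A <= act f^-1 B.
Proof. by move=> /(daut_homo (act f^-1)); rewrite actKV. Qed.

Lemma sg_transportM f A B (h : act f B = A) :
  {morph sg_transport h : x y / x * y}.
Proof.
subst A => x y; rewrite /sg_transport.
set e := etrans _ _; set e0 := group_eq_sort (equi_obj hF f B).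
have e0K z : castT e0 (castT e z) = z by rewrite (castT_comp _ _ erefl) castT_id.
have e0I : injective (castT e0).
  by move=> u v /(congr1 (castT e)); rewrite !(castT_comp _ _ erefl) !castT_id.
by apply: e0I; rewrite group_eq_mul !e0K.
Qed.

Lemma sg_transport_map f (A B A' B' : S) (h : act f B = A) (h' : act f B' = A')
    (l : B <= B') (l' : A <= A') x :
  sg_transport h' (fmap F l x) = fmap F l' (sg_transport h x).
Proof.
subst A A'; rewrite /sg_transport.
set e := etrans _ _; set e' := etrans _ _.
have e'I : injective (castT (group_eq_sort (equi_obj hF f B'))).
  by move=> u v /(congr1 (castT e)); rewrite !(castT_comp _ _ erefl) !castT_id.
apply: e'I; rewrite (bool_irrelevance l' (daut_homo (act f) l)) equi_map.
by rewrite !(castT_comp _ _ erefl) !castT_id.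
Qed.

Lemma sg_transport1 f A (h : act f A = A) x : sg_transport h x = x.
Proof. exact: castT_id. Qed.

Lemma sg_transport_comp f g k (A B C : S) (h : act f B = A) (h' : act g C = B)
    (h'' : act k C = A) x :
  sg_transport h (sg_transport h' x) = sg_transport h'' x.
Proof. exact: castT_comp. Qed.

Lemma sg_transport_one f A B (h : act f B = A) : sg_transport h 1 = 1.
Proof.
by apply: (@mulgI _ (sg_transport h 1)); rewrite -sg_transportM !mulg1.
Qed.

Lemma sg_push (A C : S) (l : A <= C) (x : F A) (f : G) :
  sg_class (SgMor x f) = sg_class (SgMor (fmap F l x) f).
Proof.
by apply/sg_classP; split=> //; exists C, l, (lexx _); rewrite fmap_id.
Qed.

Lemma sg_surj_at (X : L) (A : S) :
  exists (B : S) (x : F B) (f : G), A <= B /\ X = sg_class (SgMor x f).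
Proof.
have [[B x f] ->] := sg_class_surj X; have [C [lA lB]] := directed_ub hS A B.
by exists C, (fmap F lB x), f; split=> //; apply: sg_push.
Qed.

Lemma sg_composable_ex (X Y : L) : exists x y : mor,
  [/\ sg_composable x y, X = sg_class x & Y = sg_class y].
Proof.
have [[B y g] ->] := sg_class_surj Y; have [[A x f] ->] := sg_class_surj X.
have [C [lA lB]] := directed_ub hS A (act f B).
exists (SgMor (fmap F lA x) f), (SgMor (fmap F (act_leV lB) y) g).
by split; [split=> //=; rewrite actVK | apply: sg_push | apply: sg_push].
Qed.

Lemma sg_comp_compat (x y x' y' : mor) (h : sg_composable x y)
    (h' : sg_composable x' y') :
  sg_rel x x' -> sg_rel y y' -> sg_rel (sg_comp h) (sg_comp h').
Proof.
case: x x' y y' h h' => [A x f] [A' x' f'] [B y g] [B' y' g'] h h'.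
case=> /= ff' [C [lA [lA' ex]]] [/= gg' [D [lB [lB' ey]]]]; subst f' g'.
split=> //=; have [E [lC lD]] := directed_ub hS C (act f D).
move: (proj2 h) (proj2 h') => /= k k'.
exists E, (le_trans lA lC), (le_trans lA' lC).
rewrite !gmulfM; congr (_ * _); first exact: fmap_eq_up lC ex.
have lBE : B <= act f^-1 E := le_trans lB (act_leV lD).
have lBE' : B' <= act f^-1 E := le_trans lB' (act_leV lD).
rewrite -(sg_transport_map k (actVK f E) lBE).
rewrite -(sg_transport_map k' (actVK f E) lBE'); congr sg_transport.
exact: fmap_eq_up (act_leV lD) ey.
Qed.

Lemma eqdl_mul_ex (X Y : L) :
  exists Z : L, forall (x y : mor) (h : sg_composable x y),
    X = sg_class x -> Y = sg_class y -> Z = sg_class (sg_comp h).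
Proof.
have [x [y [h -> ->]]] := sg_composable_ex X Y.
exists (sg_class (sg_comp h)) => x' y' h' /sg_classP hx /sg_classP hy.
exact/sg_classP/sg_comp_compat.
Qed.

(* The class Z is unique, by [sg_composable_ex]. *)
Definition eqdl_mul (X Y : L) : L := projT1 (cid (eqdl_mul_ex X Y)).

Lemma eqdl_mulE (x y : mor) (h : sg_composable x y) :
  eqdl_mul (sg_class x) (sg_class y) = sg_class (sg_comp h).
Proof. by rewrite /eqdl_mul; case: cid => Z /= hZ; apply: hZ. Qed.

Lemma eqdl_mulE' (A B : S) (x : F A) (y : F B) f g (h : act f B = A) :
  eqdl_mul (sg_class (SgMor x f)) (sg_class (SgMor y g)) =
  sg_class (SgMor (x * sg_transport h y) (f * g)).
Proof.
have c : sg_composable (SgMor x f) (SgMor y g) by split.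
by rewrite (eqdl_mulE c) /sg_comp /= (Prop_irrelevance (proj2 c) h).
Qed.

Lemma eqdl_one_ex :
  exists Z : L, forall A : S, Z = sg_class (@SgMor d S G F A 1 1).
Proof.
case: hS => [[A] _]; exists (sg_class (@SgMor d S G F A 1 1)) => B.
apply/sg_classP; split=> //=; have [C [lA lB]] := directed_ub hS A B.
by exists C, lA, lB; rewrite !fmap1.
Qed.

Definition eqdl_one : L := projT1 (cid eqdl_one_ex).

Lemma eqdl_oneE A : eqdl_one = sg_class (@SgMor d S G F A 1 1).
Proof. by rewrite /eqdl_one; case: cid => Z /= h; apply: h. Qed.

Definition sg_inv (x : mor) : mor :=
  @SgMor d S G F (act (sg_act x)^-1 (sg_tgt x))
    (sg_transport erefl (sg_val x)^-1) (sg_act x)^-1.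

Definition eqdl_inv (X : L) : L :=
  sg_class (sg_inv (repr (X : {eq_quot sg_equiv}))).

Fact eqdl_mulA : associative eqdl_mul.
Proof.
move=> X Y Z.
have [[D z k] ->] := sg_class_surj Z; have [[B y g] ->] := sg_class_surj Y.
have [[A x f] ->] := sg_class_surj X.
have [C0 [lB lD]] := directed_ub hS B (act g D).
have [C [lA lC]] := directed_ub hS A (act f C0).
have lB' := le_trans lB (act_leV lC).
have lD' := act_leV (le_trans lD (act_leV lC)).
rewrite (sg_push lA) (sg_push lB') (sg_push lD').
have h1 := actVK f C; have h2 := actVK g (act f^-1 C).
have h3 : act (f * g) (act g^-1 (act f^-1 C)) = C by rewrite actM h2.
rewrite (eqdl_mulE' _ _ _ h1) (eqdl_mulE' _ _ _ h2).
rewrite (eqdl_mulE' _ _ _ h1) (eqdl_mulE' _ _ _ h3).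
by rewrite sg_transportM (sg_transport_comp _ _ h3) !mulgA.
Qed.

Fact eqdl_mul1 : left_id eqdl_one eqdl_mul.
Proof.
move=> X; have [[A x f] ->] := sg_class_surj X.
by rewrite (eqdl_oneE A) (eqdl_mulE' _ _ _ (act1 A)) sg_transport1 !mul1g.
Qed.

Fact eqdl_mulr1 : right_id eqdl_one eqdl_mul.
Proof.
move=> X; have [[A x f] ->] := sg_class_surj X.
rewrite (eqdl_oneE (act f^-1 A)) (eqdl_mulE' _ _ _ (actVK f A)).
by rewrite sg_transport_one !mulg1.
Qed.

Lemma eqdl_reprK (X : L) : X = sg_class (repr (X : {eq_quot sg_equiv})).
Proof. by rewrite /sg_class reprK. Qed.

Fact eqdl_mulV : left_inverse eqdl_one eqdl_inv eqdl_mul.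
Proof.
move=> X; rewrite {2}[X]eqdl_reprK /eqdl_inv; case: (repr _) => A x f.
rewrite /sg_inv /= (eqdl_mulE' _ _ _ erefl) -sg_transportM !mulVg.
by rewrite sg_transport_one -eqdl_oneE.
Qed.

Fact eqdl_mulrV : right_inverse eqdl_one eqdl_inv eqdl_mul.
Proof.
move=> X; rewrite {1}[X]eqdl_reprK /eqdl_inv; case: (repr _) => A x f.
rewrite /sg_inv /= (eqdl_mulE' _ _ _ (actVK f A)).
rewrite (sg_transport_comp _ _ (act1 A)) sg_transport1 !mulgV.
by rewrite -eqdl_oneE.
Qed.

HB.instance Definition _ := isGroup.Build L
  eqdl_mulA eqdl_mul1 eqdl_mulr1 eqdl_mulV eqdl_mulrV.

End EquivariantDirectLimit.

(* Main.v *)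
Require Import Defs.
From HB Require Import structures.
From mathcomp Require Import all_boot all_order.

(** Write [x] for the class of x in the direct limit and [x, f] for the class
    of the triple (A, x, f) in the equivariant direct limit, with x in F A.
    The relation on triples compares the group components by equality and the
    values exactly as the direct limit does, so [x, f] <-> ([x], f) is a
    bijection between the equivariant direct limit and the set of pairs
    (lemmas [split_classK] and [join_pairK]).

    What is left is to see which multiplication the pairs receive.  The product
    of (A, x, f) and (B, y, g) with f(B) = A is (A, x y', fg), where y' is y
    read in F A through the equality F B = F (f B) of equivariance.  Sending
    [y] to [y'] is the automorphism phi f of the direct limit: although F B
    and F A are the same group, [y] and [y'] are classes taken at the two
    different indices B and f(B), so phi f is in general not the identity.
    With this phi the product of pairs is ([x] phi f [y], fg), which is the
    semidirect product. *)

Set Implicit Arguments. Unset Strict Implicit. Unset Printing Implicit Defensive.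
Local Open Scope quotient_scope.
Local Open Scope group_scope.

Section SemidirectDecomposition.
Variables (d : Order.disp_t) (S : porderType d) (hS : directed S).
Variables (G : groupType) (act : {multiplicative G -> dirAut S}).
Variables (F : grpFunctor S) (hF : equivariant act F).

Local Notation D := (dirlim hS F).
Local Notation L := (eqdirlim hS hF).
Local Notation "[ 'cls' x ]" := (dl_in hS x).
Local Notation "[ 'cls' x , f ]" := (sg_class hS hF (SgMor x f)).

Definition shift (f : G) (X : D) : D :=
  dl_in hS (sg_transport hF erefl (tagged (repr X : dl_elt F)) : F (act f _)).

(** Transport commutes with the structure maps of F, so an equality of x and y
    witnessed at C becomes one of their transports witnessed at f(C).  The
    target is a variable A with f(B) = A because the identities below reach
    the same index by different expressions, as in (fg)(B) and f(g(B)). *)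
Lemma shiftE (f : G) (A B : S) (h : act f B = A) (x : F B) :
  shift f [cls x] = [cls sg_transport hF h x].
Proof.
rewrite /shift; have /dl_inP[C [lx [ly e]]] := dl_reprK [cls x].
apply/dl_inP; exists (act f C), (daut_homo (act f) ly).
have l : (A <= act f C)%O by rewrite -h; apply: daut_homo.
exists l; rewrite -(sg_transport_map hF erefl erefl ly).
by rewrite -(sg_transport_map hF h erefl lx) e.
Qed.

Lemma shiftM f : {morph shift f : X Y / X * Y}.
Proof.
move=> X Y; have [A [x ->]] := dl_in_surj X.
have [B [y [l ->]]] := dl_in_surj_at Y A.
rewrite -(dl_in_fmap hS l x) -gmulfM.
by rewrite !(shiftE (erefl (act f B))) sg_transportM gmulfM.
Qed.

Lemma shift1 X : shift 1 X = X.
Proof.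
have [A [x ->]] := dl_in_surj X.
by rewrite (shiftE (act1 act A)) sg_transport1.
Qed.

Lemma shift_mul f g X : shift (f * g) X = shift f (shift g X).
Proof.
have [A [x ->]] := dl_in_surj X.
rewrite (shiftE (erefl (act g A))) (shiftE (esym (actM act f g A))).
by rewrite (shiftE (erefl _)) (sg_transport_comp _ _ _ (erefl _)).
Qed.

Lemma shiftK f : cancel (shift f) (shift f^-1).
Proof. by move=> X; rewrite -shift_mul mulVg shift1. Qed.

Lemma shiftVK f : cancel (shift f^-1) (shift f).
Proof. by move=> X; rewrite -shift_mul mulgV shift1. Qed.

Definition shift_aut (f : G) : groupAut D :=
  GroupAut (@shiftM f) (@shiftK f) (@shiftVK f).

Fact shift_aut_morph : {morph shift_aut : f g / f * g}.
Proof. by move=> f g; apply: groupAut_eq => X; apply: shift_mul. Qed.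

HB.instance Definition _ :=
  isMultiplicative.Build G (groupAut D) shift_aut shift_aut_morph.

Local Notation P := (semidirect shift_aut).

Definition split_class (X : L) : P :=
  let m := repr (X : {eq_quot sg_equiv G hS F}) in
  ([cls sg_val m], sg_act m).

Definition join_pair (p : P) : L :=
  [cls tagged (repr (p.1 : D) : dl_elt F), p.2].

Lemma split_classE (A : S) (x : F A) f : split_class [cls x, f] = ([cls x], f).
Proof.
rewrite /split_class.
have /sg_classP[/= <- h] := eqdl_reprK [cls x, f].
by congr pair; apply/esym/dl_inP.
Qed.

Lemma split_classK : cancel split_class join_pair.
Proof.
move=> X; have [[A x f] ->] := sg_class_surj X.
rewrite split_classE; apply/sg_classP; split=> //=.
exact/dl_inP/esym/dl_reprK.
Qed.

Lemma join_pairK : cancel join_pair split_class.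
Proof. by case=> X f; rewrite split_classE /= -dl_reprK. Qed.

(** Every product of classes is the class of a composite, and the transport in
    the formula for a composite is the one that defines [shift]. *)
Lemma split_classM : {morph split_class : X Y / X * Y}.
Proof.
move=> X Y; have [[A x f] [[B y g] [[/= _ h] -> ->]]] := sg_composable_ex X Y.
rewrite [_ * _](eqdl_mulE' hS hF x y g h) !split_classE gmulfM.
by rewrite /= -(shiftE h).
Qed.

HB.instance Definition _ := isMultiplicative.Build L P split_class split_classM.

End SemidirectDecomposition.

Theorem theorem1p13 (d : Order.disp_t) (S : porderType d) (hS : directed S)
    (G : groupType) (act : {multiplicative G -> dirAut S})
    (F : grpFunctor S) (hF : equivariant act F) :
  exists phi : {multiplicative G -> groupAut (dirlim hS F)},
    isomorphic (eqdirlim hS hF) (semidirect phi).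
Proof.
exists (shift_aut hS hF : {multiplicative G -> groupAut (dirlim hS F)}).
exists (split_class (hF := hF)).
exact: Bijective (@split_classK _ _ _ _ _ _ _) (@join_pairK _ _ _ _ _ _ _).
Qed.
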